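(* There exists an absolute constant $c>0$ such that the following holds. Let $G$ be a graph with $n$ vertices and $t$ $6$-cycles, and let $A,B\subseteq V(G)$ be vertex subsets, not necessarily disjoint, with $1\le L=|A|\le R=|B|$. Let $m=e(A,B)$ and assume \[ m\ge 200\lceil\log n\rceil^{10}\max\!\left(RL^{1/3},\ L\sqrt{R}\right). \] Then \[ t\ge \frac{c\,m^6}{L^3R^3\log^{70}n}. \]
   Context: $e(A,B)$ denotes the number of edges of $G$ with one endpoint in $A$ and the other in $B$. $\log$ is base 2. *)

(* Defs.v *)
From HB Require Import structures.
From mathcomp Require Import all_boot all_order all_algebra.
From mathcomp Require Import all_classical all_reals all_analysis.

Set Implicit Arguments.
Unset Strict Implicit.
Unset Printing Implicit Defensive.

Import Order.TTheory GRing.Theory Num.Theory.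

Local Open Scope ring_scope.

(* A finite simple graph on V is a symmetric irreflexive adjacency relation;
   its edges are the two-element sets [set x; y] with x and y adjacent. *)
Definition simple_graph (V : finType) (adj : rel V) : Prop :=
  symmetric adj /\ irreflexive adj.

(* A and B may overlap: as edges are unordered, an edge with both endpoints in
   A :&: B is counted once. *)
Definition edges_between (V : finType) (adj : rel V) (A B : {set V}) :
  {set {set V}} := [set [set x; y] | x in A, y in B & adj x y].

Definition cycle_edges (V : finType) (p : seq V) : {set {set V}} :=
  [set [set x; next p x] | x in p].

(* k-cycles as subgraphs, for k >= 3: the 2k cyclic vertex sequences that
   traverse the same cycle have the same edge set and are counted once. *)
Definition k_cycles (V : finType) (adj : rel V) (k : nat) : {set {set {set V}}} :=
  [set cycle_edges p | p : k.-tuple V & ucycleb adj p].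

Definition log2 (R : realType) (x : R) : R := ln x / ln 2.

(* Main.v *)
Require Import Defs.
From HB Require Import structures.
From mathcomp Require Import all_boot all_order all_algebra.
From mathcomp Require Import all_classical all_reals all_analysis.
From mathcomp Require Import zify ring lra.

Set Implicit Arguments.
Unset Strict Implicit.
Unset Printing Implicit Defensive.

Import Order.TTheory GRing.Theory Num.Theory.

(* A directed cut makes A and B disjoint at the cost of a factor 4 in m, and two
   dyadic pigeonhole steps, with k = ceil (log n) classes each, make the graph
   regular on both sides up to factors 2k and 2, at the cost of k^2.  In such a
   graph let W(a, b) be the number of walks of length 3 from a to b.  Then
   hom(C6) = sum W^2 >= (sum W)^2 / (L R) >= m^6 / (4 L^3 R^3).  A noninjective
   C6-homomorphism is a C4-homomorphism with a pendant edge, so there are at most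
   6 D hom(C4) of them, D being the maximum degree, while Cauchy-Schwarz for
   hom(C4) = sum_(ab edge) W gives hom(C4)^2 <= m hom(C6).  So at least half of
   hom(C6) is injective as soon as hom(C6) >= 144 D^2 m, and the regularity turns
   this condition into m^3 >= polylog * L R^3. *)

(** * Cauchy-Schwarz for sums of natural numbers *)

Lemma cauchy_schwarz_sumn (I : finType) (f g : I -> nat) :
  (\sum_i f i * g i) ^ 2 <= (\sum_i f i ^ 2) * (\sum_i g i ^ 2).
Proof.
(* Doubling symmetrises the double sum, so that AM-GM for [f i * g j] and [f j * g i] settles each
   pair of indices. *)
rewrite -(@leq_pmul2l 2) // -mulnn !big_distrlr /=.
rewrite [leqRHS]mul2n -addnn [X in _ + X]exchange_big /= -big_split /=.
rewrite big_distrr /=; apply: leq_sum => i _.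
rewrite -big_split big_distrr /=; apply: leq_sum => j _.
have := (nat_Cauchy (f i * g j) (f j * g i)).1.
by rewrite !expnMn; nia.
Qed.

Lemma sumn_sqr_le (I : finType) (A : {set I}) (f : I -> nat) :
  (forall i, i \notin A -> f i = 0) ->
  (\sum_i f i) ^ 2 <= #|A| * \sum_i f i ^ 2.
Proof.
move=> f0; have := cauchy_schwarz_sumn (fun i => (i \in A) : nat) f.
rewrite (eq_bigr f) => [|i _]; last first.
  by case: (boolP (i \in A)) => [_|/f0->]; rewrite ?mul1n.
suff -> : \sum_i ((i \in A) : nat) ^ 2 = #|A| by [].
by rewrite -sum1_card [RHS]big_mkcond; apply: eq_bigr => i _; case: ifP.
Qed.

Lemma sum_pairE (S T : finType) (F : S * T -> nat) :
  \sum_x F x = \sum_a \sum_b F (a, b).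
Proof. by rewrite pair_bigA; apply: eq_bigr => -[]. Qed.

Lemma sum_eq_mul (T : finType) (F : T -> nat) x :
  \sum_y (x == y) * F y = F x.
Proof.
rewrite (bigD1 x) //= eqxx mul1n big1 ?addn0 // => y.
by rewrite eq_sym => /negPf->.
Qed.

(** * Counting C4- and C6-homomorphisms of a relation *)

Section HexagonCount.
Variables (V : finType) (M : rel V).

Definition ldeg (a : V) := \sum_b (M a b : nat).
Definition rdeg (b : V) := \sum_a (M a b : nat).
Definition size_rel := \sum_a ldeg a.
(* The walk x.1 - y.1 - y.2 - x.2, with x.1 and y.2 on the left side of M; a
   C6-homomorphism is a pair of such walks with the same ends x. *)
Definition path3 (x y : V * V) : nat := M x.1 y.1 * M y.2 y.1 * M y.2 x.2.
Definition num_path3 (x : V * V) := \sum_y path3 x y.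
Definition hom_C4 := \sum_x M x.1 x.2 * num_path3 x.
Definition hom_C6 := \sum_x num_path3 x ^ 2.

(** With [u = (x, (y, z))], distinctness is asked within each side; across the sides it will come
    from disjoint vertex classes. *)
Definition inj_C6 : {set V * V * ((V * V) * (V * V))} :=
  [set u | [&& path3 u.1 u.2.1 == 1, path3 u.1 u.2.2 == 1,
        uniq [:: u.1.1; u.2.1.2; u.2.2.2] & uniq [:: u.1.2; u.2.1.1; u.2.2.1]]].

Lemma size_relE : size_rel = \sum_x (M x.1 x.2 : nat).
Proof. by rewrite sum_pairE. Qed.

Lemma hom_C4_sqr_le : hom_C4 ^ 2 <= size_rel * hom_C6.
Proof.
rewrite size_relE [X in _ <= X * _](eq_bigr (fun p => (M p.1 p.2 : nat) ^ 2)).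
  exact: cauchy_schwarz_sumn.
by move=> p _; case: (M _ _).
Qed.

(** A walk is its middle edge together with one neighbour chosen at either end of it. *)
Lemma sum_num_path3 :
  \sum_x num_path3 x = \sum_a \sum_b M a b * (ldeg a * rdeg b).
Proof.
rewrite exchange_big sum_pairE exchange_big /=.
apply: eq_bigr => a' _; apply: eq_bigr => b' _.
rewrite sum_pairE mulnC -mulnA mulnC -mulnA /rdeg big_distrl /=.
apply: eq_bigr => a _.
rewrite /ldeg !big_distrr /=; apply: eq_bigr => b _.
by rewrite /path3 /=; lia.
Qed.

Section LowerBound.
Variables (A B : {set V}) (delta : nat).
Hypothesis MA : forall a b, M a b -> a \in A.
Hypothesis MB : forall a b, M a b -> b \in B.
Hypothesis rdeg_ge : forall a b, M a b -> delta <= rdeg b.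

(** One factor of the cube is bounded by [delta.*2 * #|B|], the other two by Cauchy-Schwarz on the
    left degrees; an edge [ab] is the middle of at least [delta * ldeg a] walks. *)
Lemma size_rel_cube_le : size_rel <= delta.*2 * #|B| ->
  size_rel ^ 3 <= 2 * #|A| * #|B| * \sum_x num_path3 x.
Proof.
move=> sizeB.
have h1 : size_rel ^ 2 <= #|A| * \sum_a ldeg a ^ 2.
  apply: sumn_sqr_le => a aA; apply: big1 => b _.
  by apply/eqP; rewrite eqb0; apply: contra aA => /MA.
have h2 : delta * (\sum_a ldeg a ^ 2) <= \sum_x num_path3 x.
  rewrite sum_num_path3 big_distrr /=; apply: leq_sum => a _.
  rewrite -mulnn {1}/ldeg big_distrl big_distrr /=; apply: leq_sum => b _.
  case Mab : (M a b); last by rewrite mul0n muln0.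
  by rewrite !mul1n mulnC leq_mul2l (rdeg_ge Mab) orbT.
rewrite expnS (leq_trans (leq_mul sizeB h1)) //.
rewrite (_ : _ * _ = 2 * #|A| * #|B| * (delta * \sum_a ldeg a ^ 2)).
  by rewrite leq_mul2l h2 orbT.
by rewrite -muln2; ring.
Qed.

Lemma path3_sum_sqr_le :
  (\sum_x num_path3 x) ^ 2 <= #|A| * #|B| * hom_C6.
Proof.
rewrite -cardsX; apply: sumn_sqr_le => -[a b].
rewrite finset.in_setX => abN; apply: big1 => -[b' a'] _.
apply/eqP; rewrite /path3 !muln_eq0 !eqb0 /=; move: abN; apply: contraR.
by rewrite !negb_or !negbK => /andP[/andP[/MA-> _] /MB->].
Qed.

Lemma hom_C6_ge : size_rel <= delta.*2 * #|B| ->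
  size_rel ^ 6 <= 4 * #|A| ^ 3 * #|B| ^ 3 * hom_C6.
Proof.
move=> /size_rel_cube_le h1; have h2 := path3_sum_sqr_le.
rewrite (expnM _ 3 2).
have := leq_mul h1 h1; rewrite mulnn => /leq_trans; apply.
set S := \sum_x _ in h2 *.
rewrite (_ : _ * _ = 4 * (#|A| * #|B|) ^ 2 * S ^ 2); last by ring.
rewrite (leq_trans (leq_mul (leqnn _) h2)) //.
by apply: eq_leq; ring.
Qed.
End LowerBound.

Section Degenerate.
Variable D : nat.
Hypothesis ldeg_le : forall a, ldeg a <= D.
Hypothesis rdeg_le : forall b, rdeg b <= D.

(** In use, [P] is one of the six coincidences between two vertices on the same side. *)
Let degenerate (P : V * V -> V * V -> V * V -> bool) :=
  \sum_x \sum_y \sum_z P x y z * (path3 x y * path3 x z).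

Lemma degenerate_swap P :
  degenerate (fun x y z => P x z y) = degenerate P.
Proof.
apply: eq_bigr => x _; rewrite exchange_big; apply: eq_bigr => y _.
by apply: eq_bigr => z _; rewrite (mulnC (path3 x z)).
Qed.

(** When [y] collapses onto the edge joining its ends, in at most [D] ways, that edge and the walk
    [z] form a C4-homomorphism. *)
Lemma degenerate_end_le (P : V * V -> V * V -> bool) :
  (forall x, \sum_y P x y * path3 x y <= D * M x.1 x.2) ->
  degenerate (fun x y _ => P x y) <= D * hom_C4.
Proof.
move=> PD; rewrite /hom_C4 big_distrr /=; apply: leq_sum => x _.
rewrite mulnA (leq_trans _ (leq_mul (PD x) (leqnn _))) //.
rewrite big_distrl /=; apply: leq_sum => y _.
by rewrite big_distrr /=; apply: leq_sum => z _; rewrite mulnA.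
Qed.

Lemma degenerate_ll : degenerate (fun x y _ => x.1 == y.2) <= D * hom_C4.
Proof.
apply: degenerate_end_le => -[a b]; rewrite sum_pairE /=.
under eq_bigr => b' _ do rewrite sum_eq_mul /path3 /= mulnb andbb.
by rewrite -big_distrl leq_mul2r ldeg_le orbT.
Qed.

Lemma degenerate_rr : degenerate (fun x y _ => x.2 == y.1) <= D * hom_C4.
Proof.
apply: degenerate_end_le => -[a b]; rewrite sum_pairE exchange_big /=.
under eq_bigr => b' _ do rewrite sum_eq_mul /path3 /= -mulnA mulnb andbb mulnC.
by rewrite -big_distrl leq_mul2r rdeg_le orbT.
Qed.

(** Once [y.2 = z.2], the end [x.2] is a pendant neighbour of this vertex, with at most [D] choices;
    the other four vertices form the C4. *)
Lemma degenerate_ll' : degenerate (fun _ y z => y.2 == z.2) <= D * hom_C4.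
Proof.
rewrite /degenerate sum_pairE /hom_C4 sum_pairE big_distrr /=.
apply: leq_sum => a _.
under eq_bigr => b _ do rewrite sum_pairE.
rewrite exchange_big big_distrr /=; apply: leq_sum => b' _.
rewrite /num_path3 sum_pairE [X in D * (_ * X)]exchange_big [leqLHS]exchange_big /=.
rewrite !big_distrr /=; apply: leq_sum => a' _.
under eq_bigr => b _.
  rewrite sum_pairE /=.
  under eq_bigr => b'' _ do rewrite sum_eq_mul.
  over.
rewrite [leqLHS]exchange_big !big_distrr /=; apply: leq_sum => b'' _.
apply: leq_trans (leq_mul (ldeg_le a') (leqnn _)).
rewrite /ldeg big_distrl /=; apply: leq_sum => b _.
by rewrite /path3 /=; do 5?[case: (M _ _) => /=].
Qed.

(** Here the pendant vertex is [x.1], attached to [y.1 = z.1]. *)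
Lemma degenerate_rr' : degenerate (fun _ y z => y.1 == z.1) <= D * hom_C4.
Proof.
rewrite /degenerate exchange_big /hom_C4 !sum_pairE exchange_big big_distrr /=.
apply: leq_sum => a' _; rewrite big_distrr; apply: leq_sum => b' _.
rewrite /num_path3 !sum_pairE [leqLHS]exchange_big !big_distrr.
apply: leq_sum => b _ /=.
under eq_bigr => a _.
  rewrite sum_pairE exchange_big /=.
  under eq_bigr => a'' _ do rewrite sum_eq_mul.
  over.
rewrite [leqLHS]exchange_big !big_distrr /=; apply: leq_sum => a'' _.
apply: leq_trans (leq_mul (rdeg_le b') (leqnn _)).
rewrite /rdeg big_distrl /=; apply: leq_sum => a _.
by rewrite /path3 /=; do 5?[case: (M _ _) => /=].
Qed.

(** A union bound over the three pairs of vertices on each side; [degenerate_swap] carries the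
    coincidences of [x] with [y] over to [z]. *)
Lemma hom_C6_le : hom_C6 <= #|inj_C6| + 6 * (D * hom_C4).
Proof.
have := degenerate_ll; have := degenerate_rr.
have := degenerate_ll; have := degenerate_rr.
rewrite -(degenerate_swap (fun x y _ => x.1 == y.2)).
rewrite -(degenerate_swap (fun x y _ => x.2 == y.1)).
move=> h1 h2; have h3 := degenerate_ll; have h4 := degenerate_rr.
have h5 := degenerate_ll'; have h6 := degenerate_rr'.
pose g u := (u \in inj_C6) : nat.
suff H : hom_C6 <= \sum_u g u + (degenerate (fun x _ y => x.1 == y.2)
   + degenerate (fun x _ y => x.2 == y.1) 
   + degenerate (fun x y _ => x.1 == y.2)
   + degenerate (fun x y _ => x.2 == y.1) 
   + degenerate (fun _ y z => y.2 == z.2)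
   + degenerate (fun _ y z => y.1 == z.1)).
  have -> : #|inj_C6| = \sum_u g u.
    rewrite -sum1_card big_mkcond; apply: eq_bigr => u _.
    by rewrite /g; case: ifP.
  by lia.
rewrite sum_pairE -!big_split /=; apply: leq_sum => x _.
rewrite sum_pairE -!big_split /= -mulnn big_distrlr /=; apply: leq_sum => y _.
rewrite -!big_split; apply: leq_sum => z _ /=.
rewrite /g inE /= /path3 !mulnb !in_cons !in_nil !orbF !negb_or !andbT.
set p := _ && M y.2 x.2; set q := _ && M z.2 x.2.
case: p; case: q => //=.
by do 6![case: (_ == _) => //=].
Qed.
End Degenerate.

Lemma inj_C6_ge (A B : {set V}) (delta D : nat) :
  (forall a b, M a b -> a \in A) -> (forall a b, M a b -> b \in B) ->
  (forall a b, M a b -> delta <= rdeg b) ->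
  (forall a, ldeg a <= D) -> (forall b, rdeg b <= D) ->
  size_rel <= delta.*2 * #|B| ->
  24 ^ 2 * D ^ 2 * #|A| ^ 3 * #|B| ^ 3 <= size_rel ^ 5 ->
  size_rel ^ 6 <= 8 * #|A| ^ 3 * #|B| ^ 3 * #|inj_C6|.
Proof.
move=> MA MB dge lD rD sB sD.
have T1 := hom_C6_ge MA MB dge sB; have T2 := hom_C6_le lD rD.
have T3 := hom_C4_sqr_le.
rewrite -!(mulnA _ (#|A| ^ 3)) in T1 sD *.
set K := #|A| ^ 3 * #|B| ^ 3 in T1 sD *.
have [K0|K0] := posnP K; first by move: T1; rewrite K0 !muln0.
(* [24 ^ 2 = 4 * 12 ^ 2]: the [4] cancels the one in [T1], and [12 = 2 * 6] makes the degenerate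
   homomorphisms at most half of all. *)
have T4 : 144 * D ^ 2 * size_rel <= hom_C6.
  rewrite -(@leq_pmul2l (4 * K)); last by rewrite (muln_gt0 4).
  rewrite (leq_trans _ T1) //.
  have := leq_mul sD (leqnn size_rel); rewrite -expnSr; apply: leq_trans.
  by apply: eq_leq; ring.
(* Hence at least half of the homomorphisms are injective. *)
have T5 : 12 * D * hom_C4 <= hom_C6.
  rewrite -leq_sqr !expnMn (leq_trans (leq_mul (leqnn _) T3)) //.
  by rewrite mulnA -(mulnn hom_C6) leq_mul2r T4 orbT.
apply: leq_trans T1 _.
rewrite (_ : 8 * K * _ = 4 * K * (2 * #|inj_C6|)); last by ring.
by rewrite leq_mul2l; apply/orP; right; lia.
Qed.
End HexagonCount.

(** * Dyadic regularisation *)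

Lemma dyadic_class (T : finType) (A : {set T}) (f : T -> nat) k :
  (forall x, f x < 2 ^ k) ->
  exists i, exists2 A' : {set T}, A' \subset A &
    (forall x, x \in A' -> 2 ^ i <= f x < 2 ^ i.+1) /\
    \sum_(x in A) f x <= k * \sum_(x in A') f x.
Proof.
case: k => [|k] fk.
  exists 0, finset.set0; rewrite ?finset.sub0set //; split=> [x|].
    by rewrite inE.
  by rewrite big1 // => x _; move: (fk x); rewrite ltnS leqn0 => /eqP.
(* Positive values are grouped by [trunc_log], and the class with the largest sum reaches the
   average. Zeros lie in no class and add nothing. *)
pose C (i : 'I_k.+1) := [set x in A | (0 < f x) && (trunc_log 2 (f x) == i)].
pose g i := \sum_(x in C i) f x.
have [i _ gi] := @arg_maxnP _ ord0 predT g isT.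
exists i, (C i); first by apply/fintype.subsetP => x; rewrite inE => /andP[].
split=> [x|].
  by rewrite inE => /and3P[_ x0 /eqP<-]; exact: trunc_log_bounds.
suff -> : \sum_(x in A) f x = \sum_i g i.
  apply: (@leq_trans (\sum_(j < k.+1) g i)).
    by apply: leq_sum => j _; exact: gi.
  by rewrite sum_nat_const card_ord.
rewrite (bigID (fun x => 0 < f x)) /= [X in _ + X]big1 ?addn0; last first.
  by move=> x /andP[_]; rewrite lt0n negbK => /eqP.
rewrite (partition_big (fun x => inord (trunc_log 2 (f x)) : 'I_k.+1) predT) //=.
apply: eq_bigr => j _; apply: eq_bigl => x; rewrite !inE -andbA.
case: (x \in A) => //=; case: posnP => //= x0.
rewrite -val_eqE /= inordK //.
rewrite -(ltn_exp2l _ _ (ltnSn 1)).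
exact: leq_ltn_trans (trunc_logP _ x0) (fk x).
Qed.

(* The second selection, by right degree, keeps at least 1/k of the edges, so
   the bound p on the left degrees stays within a factor 2k of the average. *)
Lemma regular_subrel (V : finType) (M : rel V) (A B : {set V}) k :
  (forall a b, M a b -> a \in A) -> (forall a b, M a b -> b \in B) ->
  (forall a, ldeg M a < 2 ^ k) -> (forall b, rdeg M b < 2 ^ k) ->
  exists (M' : rel V) (A' B' : {set V}) (p q : nat),
  [/\ subrel M' M, A' \subset A & B' \subset B] /\
  [/\ forall a b, M' a b -> a \in A', forall a b, M' a b -> b \in B',
      forall a, ldeg M' a <= p.*2, forall b, rdeg M' b <= q.*2 &
      forall a b, M' a b -> q <= rdeg M' b] /\
  [/\ p * #|A'| <= k * size_rel M', q * #|B'| <= size_rel M',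
      size_rel M' <= q.*2 * #|B'| & size_rel M <= k ^ 2 * size_rel M'].
Proof.
move=> MA MB lk rk.
have [i [A' sA [fA sumA]]] := dyadic_class A lk.
pose M1 := [rel a b | (a \in A') && M a b].
have M1M : subrel M1 M by move=> a b /andP[].
have rk1 b : rdeg M1 b < 2 ^ k.
  by apply: leq_ltn_trans (rk b); apply: leq_sum => a _ /=; case: (a \in A').
have [j [B' sB [fB sumB]]] := dyadic_class B rk1.
pose M2 := [rel a b | (b \in B') && M1 a b].
have M21 : subrel M2 M1 by move=> a b /andP[].
(* Restricting to [B'] keeps the right degrees there but may lower left degrees, so lower bounds on
   degrees survive on the right side. *)
have rM2 b : b \in B' -> rdeg M2 b = rdeg M1 b.
  by move=> bB; apply: eq_bigr => a _ /=; rewrite bB.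
have rM20 b : b \notin B' -> rdeg M2 b = 0.
  by move=> bB; apply: big1 => a _ /=; rewrite (negPf bB).
have size1 : size_rel M1 = \sum_(a in A') ldeg M a.
  rewrite [RHS]big_mkcond; apply: eq_bigr => a _.
  by case: ifP => aA; [apply: eq_bigr|apply: big1] => b _ /=; rewrite aA.
have size2 : size_rel M2 = \sum_(b in B') rdeg M1 b.
  rewrite /size_rel exchange_big [RHS]big_mkcond; apply: eq_bigr => b _.
  by case: ifP => bB; [exact: rM2|apply: rM20; rewrite bB].
have sizeM : size_rel M <= k * size_rel M1.
  rewrite size1 (leq_trans _ sumA) // [leqRHS]big_mkcond leq_sum // => a _.
  case: ifPn => // aA; rewrite leqn0; apply/eqP/big1 => b _.
  by apply/eqP; rewrite eqb0; apply: contra aA => /MA.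
have sizeM1 : size_rel M1 <= k * size_rel M2.
  rewrite size2 (leq_trans _ sumB) // [leqRHS]big_mkcond /size_rel exchange_big.
  apply: leq_sum => b _.
  case: ifPn => // bB; rewrite leqn0; apply/eqP/big1 => a _.
  by apply/eqP; rewrite eqb0; apply: contra bB => /M1M/MB.
exists M2, A', B', (2 ^ i), (2 ^ j); split; [split|split; split] => //.
- by move=> a b /M21/M1M.
- by move=> a b /and3P[].
- by move=> a b /and3P[].
- move=> a; rewrite -mul2n -expnS; case: (boolP (a \in A')) => aA.
    have /andP[_ /ltnW] := fA _ aA; apply: leq_trans; apply: leq_sum => b _ /=.
    by case: (b \in B'); rewrite // aA.
  by rewrite [ldeg _ _]big1 // => b _ /=; rewrite (negPf aA) andbF.
- move=> b; rewrite -mul2n -expnS; case: (boolP (b \in B')) => bB.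
    by rewrite rM2 //; have /andP[_ /ltnW] := fB _ bB.
  by rewrite rM20.
- by move=> a b /andP[bB _]; rewrite rM2 //; have /andP[] := fB _ bB.
- rewrite (leq_trans _ sizeM1) // size1 mulnC -sum_nat_const leq_sum // => a /fA.
  by case/andP.
- rewrite size2 mulnC -sum_nat_const leq_sum // => b /fB.
  by case/andP.
- rewrite size2 mulnC -sum_nat_const leq_sum // => b /fB/andP[_ /ltnW].
  by rewrite expnS mul2n.
- by rewrite (leq_trans sizeM) // -mulnn -mulnA leq_mul2l sizeM1 orbT.
Qed.

(** * Supersaturation of injective homomorphisms *)

Lemma inj_C6_sub (V : finType) (M M' : rel V) :
  subrel M' M -> inj_C6 M' \subset inj_C6 M.
Proof.
move=> sM; apply/fintype.subsetP => u; rewrite !inE => /and4P[h1 h2 -> ->].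
have sP x y : path3 M' x y == 1 -> path3 M x y == 1.
  by rewrite /path3 !mulnb !eqb1 => /andP[/andP[/sM-> /sM->] /sM->].
by rewrite !sP.
Qed.

(** Regularising divides the size by at most [k ^ 2], whence [k ^ 12] in the sixth power and [k ^ 6]
    in the cubed hypothesis; the other [k ^ 2] of [k ^ 8] pays for [p * #|A'| <= k * s]. *)
Lemma inj_C6_supersaturation (V : finType) (M : rel V) (A B : {set V}) k :
  0 < k ->
  (forall a b, M a b -> a \in A) -> (forall a b, M a b -> b \in B) ->
  (forall a, ldeg M a < 2 ^ k) -> (forall b, rdeg M b < 2 ^ k) ->
  #|A| <= #|B| ->
  48 ^ 2 * k ^ 8 * (#|A| * #|B| ^ 3) <= size_rel M ^ 3 ->
  size_rel M ^ 6 <= 8 * k ^ 12 * (#|A| ^ 3 * #|B| ^ 3) * #|inj_C6 M|.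
Proof.
move=> k0 MA MB lk rk AB big_M.
have [M' [A' [B' [p [q [[sM sA sB] [[MA' MB' lM rM dM] [hp hq hs hM]]]]]]]] :=
  regular_subrel MA MB lk rk.
set s := size_rel M' in hp hq hs hM.
have {}sA := subset_leq_card sA; have {}sB := subset_leq_card sB.
have sX := subset_leq_card (inj_C6_sub sM).
have big_s : 48 ^ 2 * k ^ 2 * (#|A| * #|B| ^ 3) <= s ^ 3.
  rewrite -(@leq_pmul2l (k ^ 6)) ?expn_gt0 ?k0 //.
  move: hM; rewrite -(leq_exp2r _ _ (isT : 0 < 3)) => hM.
  move: (leq_trans big_M hM); rewrite expnMn -expnM => h.
  by apply: leq_trans _ h; apply: eq_leq; ring.
have D5 : 24 ^ 2 * (maxn p.*2 q.*2) ^ 2 * #|A'| ^ 3 * #|B'| ^ 3 <= s ^ 5.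
  (* The square of the larger degree bound is absorbed, with two factors of the size of its side, by
     [s ^ 2] up to [k ^ 2]; the doubled bounds turn [24] into [48]. *)
  have [pq|qp] := leqP p.*2 q.*2.
    have h : (q * #|B'|) ^ 2 <= s ^ 2 by rewrite leq_sqr.
    have h' : 48 ^ 2 * (#|A'| ^ 3 * #|B'|) <= s ^ 3.
      apply: leq_trans big_s; apply: leq_mul.
        by rewrite leq_pmulr // expn_gt0 k0.
      (* The hypothesis has the shape [#|A| * #|B| ^ 3], so two factors [#|A'|] are traded for
         [#|B|]. *)
      have sAB := leq_trans sA AB.
      have := leq_mul (leq_mul sA sB) (leq_mul sAB sAB).
      by congr (_ <= _); ring.
    rewrite (expnD s 2 3) (leq_trans _ (leq_mul h h')) //.
    by apply: eq_leq; rewrite -muln2; ring.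
  have h : (p * #|A'|) ^ 2 <= (k * s) ^ 2 by rewrite leq_sqr.
  have h' : 48 ^ 2 * k ^ 2 * (#|A'| * #|B'| ^ 3) <= s ^ 3.
    by apply: leq_trans big_s; rewrite !leq_mul // leq_exp2r.
  rewrite -(@leq_pmul2l (k ^ 2)) ?expn_gt0 ?k0 //.
  have := leq_mul h h'; rewrite (expnMn k) -(mulnA (k ^ 2)) -expnD.
  apply: leq_trans.
  by apply: eq_leq; rewrite -muln2; ring.
have := @inj_C6_ge _ M' A' B' q _ MA' MB' dM
  (fun a => leq_trans (lM a) (leq_maxl _ _))
  (fun b => leq_trans (rM b) (leq_maxr _ _)) hs D5.
move=> main; have {}hM : size_rel M ^ 6 <= k ^ 12 * s ^ 6.
  by rewrite (expnM k 2 6) -expnMn leq_exp2r.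
apply: (leq_trans hM); apply: leq_trans (leq_mul (leqnn _) main) _.
rewrite (_ : _ * _ = 8 * k ^ 12 * (#|A'| ^ 3 * #|B'| ^ 3) * #|inj_C6 M'|).
  by rewrite !leq_mul // leq_exp2r.
by ring.
Qed.

(** * From injective homomorphisms to 6-cycles *)

Lemma leq_card_fibers (S T : finType) (X : {set S}) (f : S -> T) K :
  (forall u, u \in X -> #|[set v in X | f v == f u]| <= K) ->
  #|X| <= K * #|f @: X|.
Proof.
move=> fib; rewrite -sum1_card (partition_big_imset f) /= mulnC.
rewrite -sum_nat_const; apply: leq_sum => _ /imsetP[u uX ->].
by rewrite (leq_trans _ (fib u uX)) // -sum1dep_card.
Qed.

(** Cyclic order: the first walk forwards, then the inner vertices of the second one backwards. *)
Definition hexagon (V : finType) (u : V * V * ((V * V) * (V * V))) : 6.-tuple V :=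
  [tuple u.1.1; u.2.1.1; u.2.1.2; u.1.2; u.2.2.2; u.2.2.1].

Lemma cover_cycle_edges (V : finType) (p : seq V) :
  finset.cover (cycle_edges p) = [set x in p].
Proof.
apply/setP => x; rewrite inE; apply/bigcupP/idP => [[_ /imsetP[y yp ->]]|xp].
  by rewrite !inE => /orP[] /eqP-> //; rewrite path.mem_next.
by exists [set x; next p x]; [exact: imset_f | rewrite !inE eqxx].
Qed.

(* The edge set determines the vertex set of the hexagon, hence each fibre of
   the map to edge sets has at most 6 ^ 6 elements. *)
Lemma card_inj_C6_le (V : finType) (adj M : rel V) (A B : {set V}) :
  symmetric adj -> subrel M adj -> [disjoint A & B] ->
  (forall a b, M a b -> a \in A) -> (forall a b, M a b -> b \in B) ->
  #|inj_C6 M| <= 6 ^ 6 * #|k_cycles adj 6|.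
Proof.
move=> sym_adj sM dAB MA MB.
pose f u := cycle_edges (@hexagon V u).
have sub : f @: inj_C6 M \subset k_cycles adj 6.
  apply/fintype.subsetP => _ /imsetP[u uM ->]; apply: imset_f; rewrite inE.
  move: u uM => [[a b] [[b' a'] [b'' a'']]]; rewrite !inE /path3 /= !mulnb !eqb1.
  case/and4P=> /andP[/andP[m1 m2] m3] /andP[/andP[m4 m5] m6].
  rewrite !inE !andbT !negb_or => /andP[/andP[n1 n2] n3] /andP[/andP[n4 n5] n6].
  (* Vertices on opposite sides differ because [A] and [B] are disjoint. *)
  have neq x y z w : M x y -> M z w -> x != w.
    move=> /MA xA /MB wB; apply: contraTneq xA => ->.
    by rewrite (disjointFl dAB wB).
  rewrite /ucycleb /= !inE !negb_or !andbT.
  rewrite (sym_adj b' a') (sym_adj b a'') (sym_adj b'' a) !sM // (eq_sym b' b).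
  rewrite n1 n2 n3 n4 n5 n6.
  rewrite (neq _ _ _ _ m1 m1) (neq _ _ _ _ m1 m3) (neq _ _ _ _ m1 m4).
  rewrite (neq _ _ _ _ m2 m3) (neq _ _ _ _ m2 m4) (neq _ _ _ _ m5 m5).
  rewrite !(eq_sym _ a') !(eq_sym _ a'').
  by rewrite (neq _ _ _ _ m2 m2) (neq _ _ _ _ m5 m1) (neq _ _ _ _ m6 m6).
apply: leq_trans (leq_mul (leqnn _) (subset_leq_card sub)).
apply: leq_card_fibers => u _.
set C := finset.cover (f u).
have C6 : #|C| <= 6.
  by rewrite /C cover_cycle_edges cardsE (leq_trans (card_size _)).
have : [set v in inj_C6 M | f v == f u] \subset
   finset.setX (finset.setX C C) (finset.setX (finset.setX C C) (finset.setX C C)).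
  apply/fintype.subsetP => -[[a b] [[b' a'] [b'' a'']]].
  rewrite inE => /andP[_ /eqP fuv].
  by rewrite !finset.in_setX /C -fuv cover_cycle_edges !inE !eqxx !orbT.
move=> /subset_leq_card /leq_trans; apply.
rewrite !cardsX (_ : 6 ^ 6 = 6 * 6 * (6 * 6 * (6 * 6))) //.
by do ![apply: leq_mul].
Qed.

(** * Directed cuts and the bound for general graphs *)

Lemma card_separating (V : finType) (x y : V) : x != y ->
  2 ^ #|V| <= 4 * #|[set S : {set V} | (x \in S) && (y \notin S)]|.
Proof.
(* Adding [x] sends the [2 ^ (#|V| - 2)] subsets of [U] injectively to separating sets. *)
move=> xy; pose U := ~: [set x; y].
have cU : #|V| = 2 + #|U| by rewrite -(cardsC [set x; y]) cards2 xy.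
rewrite cU expnD leq_mul2l /= -card_powerset.
have inj : {in powerset U &, injective (fun S => x |: S)}.
  move=> S T; rewrite !inE => SU TU eqST.
  have xN (W : {set V}) : W \subset U -> x \notin W.
    by move=> sW; apply/negP => /(fintype.subsetP sW); rewrite !inE eqxx.
  by rewrite -(setU1K (xN S SU)) eqST setU1K // xN.
rewrite -(card_in_imset inj).
apply/subset_leq_card/fintype.subsetP => _ /imsetP[S SU ->].
rewrite !inE eqxx /= negb_or eq_sym xy /=; move: SU; rewrite inE => sW.
by apply/negP => /(fintype.subsetP sW); rewrite !inE eqxx orbT.
Qed.

(** Each ordered pair is cut by at least a quarter of all sets [S], so a maximising [S] does at
    least as well as this average. *)
Lemma directed_cut (V : finType) (M : rel V) : irreflexive M ->
  exists S : {set V},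
    size_rel M <= 4 * size_rel [rel a b | [&& a \in S, b \notin S & M a b]].
Proof.
move=> irrM.
pose g (S : {set V}) := size_rel [rel a b | [&& a \in S, b \notin S & M a b]].
have [S _ gS] := @arg_maxnP _ finset.set0 predT g isT; exists S.
rewrite -(@leq_pmul2l (2 ^ #|V|)) ?expn_gt0 //.
apply: (@leq_trans (4 * \sum_T g T)).
  rewrite /g; under eq_bigr => T _ do rewrite size_relE.
  rewrite exchange_big /= size_relE !big_distrr /=; apply: leq_sum => -[x y] _ /=.
  case Mxy : (M x y); last by rewrite muln0.
  have xy : x != y by apply: contraTneq Mxy => ->; rewrite irrM.
  rewrite muln1 (leq_trans (card_separating xy)) // leq_mul2l /=.
  rewrite -sum1dep_card big_mkcond; apply: leq_sum => T _.
  by rewrite andbT; case: (_ && _).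
rewrite mulnCA leq_mul2l /=.
apply: (@leq_trans (\sum_(T : {set V}) g S)).
  by apply: leq_sum => T _; exact: gS.
by rewrite sum_nat_const -cardsT -powersetT card_powerset cardsT.
Qed.

(** An edge inside [A :&: B] arises from two ordered pairs, hence an inequality. *)
Lemma card_edges_between_le (V : finType) (adj : rel V) (A B : {set V}) :
  #|edges_between adj A B| <= size_rel [rel a b | [&& a \in A, b \in B & adj a b]].
Proof.
pose P := [set x : V * V | [&& x.1 \in A, x.2 \in B & adj x.1 x.2]].
have : edges_between adj A B \subset [set [set x.1; x.2] | x in P].
  apply/fintype.subsetP => e /imset2P[a b aA]; rewrite inE => /andP[bB ab] ->.
  by apply/imsetP; exists (a, b); rewrite // inE aA bB.
move=> /subset_leq_card/leq_trans; apply.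
rewrite (leq_trans (leq_imset_card _ _)) // size_relE -sum1dep_card big_mkcond.
by apply: leq_sum => x _ /=; case: ifP.
Qed.

Lemma C6_supersaturation (V : finType) (adj : rel V) (A B : {set V}) k :
  simple_graph adj -> 0 < k -> #|V| <= 2 ^ k -> #|A| <= #|B| ->
  4 ^ 3 * (48 ^ 2 * k ^ 8 * (#|A| * #|B| ^ 3)) <= #|edges_between adj A B| ^ 3 ->
  #|edges_between adj A B| ^ 6 <=
    4 ^ 6 * (8 * k ^ 12 * (#|A| ^ 3 * #|B| ^ 3) * (6 ^ 6 * #|k_cycles adj 6|)).
Proof.
move=> [sym_adj irr_adj] k0 Vk AB.
set m := #|edges_between adj A B| => big_m.
pose M0 := [rel a b | [&& a \in A, b \in B & adj a b]].
have irr0 : irreflexive M0 by move=> x /=; rewrite irr_adj !andbF.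
have [S] := directed_cut irr0.
set M := [rel a b | _] => cut.
have mM : m <= 4 * size_rel M := leq_trans (card_edges_between_le _ _ _) cut.
have sM : subrel M adj by move=> a b /and5P[].
have irrM a : M a a = false by apply/negP => /sM; rewrite irr_adj.
(* A vertex is not its own neighbour, which makes the degree strictly smaller than [#|V|]. *)
have deg_lt (P : pred V) a : P a = false -> \sum_b (P b : nat) < 2 ^ k.
  move=> Pa; apply: leq_trans Vk; rewrite -sum1_card.
  rewrite [ltnRHS](bigD1 a) //= ltnS (bigD1 a) //= Pa add0n.
  by apply: leq_sum => b _; case: (P b).
have MA a b : M a b -> a \in A :&: S by case/and5P=> aS _ aA _ _; rewrite inE aA.
have MB a b : M a b -> b \in B :\: S by case/and5P=> _ bS _ bB _; rewrite inE bS.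
have MA' a b : M a b -> a \in A by case/MA/setIP.
have MB' a b : M a b -> b \in B by case/MB/setDP.
have dAB : [disjoint A :&: S & B :\: S].
  rewrite -setI_eq0; apply/eqP/setP => x; rewrite !inE.
  by case: (x \in S); rewrite ?andbF.
have mM3 : m ^ 3 <= 4 ^ 3 * size_rel M ^ 3 by rewrite -expnMn leq_exp2r.
have mM6 : m ^ 6 <= 4 ^ 6 * size_rel M ^ 6 by rewrite -expnMn leq_exp2r.
have big_M : 48 ^ 2 * k ^ 8 * (#|A| * #|B| ^ 3) <= size_rel M ^ 3.
  by rewrite -(@leq_pmul2l (4 ^ 3)) //; exact: leq_trans big_m mM3.
have main := inj_C6_supersaturation k0 MA' MB'
  (fun a => deg_lt (M a) a (irrM a))
  (fun b => deg_lt (fun a => M a b) b (irrM b)) AB big_M.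
have fib := card_inj_C6_le sym_adj sM dAB MA MB.
apply: leq_trans mM6 _; rewrite leq_mul2l; apply/orP; right.
by apply: leq_trans main _; rewrite leq_mul2l fib orbT.
Qed.

(** * Logarithms and the real form of the bound *)

Local Open Scope ring_scope.

Lemma log2_ge1 (R : realType) (n : nat) : (1 < n)%N -> 1 <= log2 (n%:R : R).
Proof.
move=> n1; have n0 : 0 < n%:R :> R by rewrite ltr0n ltnW.
have l2 : 0 < ln 2 :> R by apply: ln_gt0; rewrite ltr1n.
by rewrite /log2 ler_pdivlMr // mul1r ler_ln ?posrE // ler_nat.
Qed.

(** Rounding up adds less than 1, which is at most [log2 x]. *)
Lemma ceil_log2_le (R : realType) (x : R) :
  1 <= log2 x -> (Num.ceil (log2 x))%:~R <= 2 * log2 x.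
Proof. by move=> x1; have := ceilB1_lt (log2 x); rewrite intrB; lra. Qed.

Lemma natr_le_exp2 (R : realType) (n k : nat) :
  (0 < n)%N -> log2 (n%:R : R) <= k%:R -> (n <= 2 ^ k)%N.
Proof.
move=> n0; have l2 : 0 < ln 2 :> R by apply: ln_gt0; rewrite ltr1n.
rewrite /log2 ler_pdivrMr // mulr_natl -lnXn ?ltr0n //.
rewrite ler_ln ?posrE ?exprn_gt0 ?ltr0n //.
by rewrite -natrX ler_nat.
Qed.

Theorem corollary4p1 (R : realType) :
  exists c : R, 0 < c /\
    forall (V : finType) (adj : rel V), simple_graph adj ->
    forall A B : {set V}, (1 <= #|A|)%N -> (#|A| <= #|B|)%N ->
    let n : R := #|V|%:R in
    let t : R := #|k_cycles adj 6|%:R in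
    let m : R := #|edges_between adj A B|%:R in
    let l : R := #|A|%:R in
    let r : R := #|B|%:R in
    200 * (Num.ceil (log2 n))%:~R ^+ 10
        * Num.max (r * l `^ (1 / 3)) (l * Num.sqrt r) <= m ->
    c * m ^+ 6 / (l ^+ 3 * r ^+ 3 * log2 n ^+ 70) <= t.
Proof.
(* [4 ^+ 6] comes from the cut, [8] from counting injective homomorphisms, [6 ^+ 6] from the fibres
   over 6-cycles, and [2 ^+ 12] from [k <= 2 * log2 n]. *)
pose C : R := 4 ^+ 6 * 8 * 6 ^+ 6 * 2 ^+ 12.
have C0 : 0 < C by rewrite /C !mulr_gt0 ?exprn_gt0 ?ltr0n.
exists C^-1; split; first by rewrite invr_gt0.
move=> V adj Gadj A B A1 AB n t m l r hm.
have t0 : 0 <= t by rewrite ler0n.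
have V0 : (0 < #|V|)%N by apply: leq_trans A1 (max_card _).
have [V1|V1] := leqP #|V| 1.
  have -> : log2 n = 0.
    rewrite /n (_ : #|V| = 1%N) ?/log2 ?ln1 ?mul0r //.
    by apply/eqP; rewrite eqn_leq V1.
  (* The denominator is 0, and so is the quotient. *)
  by rewrite expr0n mulr0 invr0 mulr0.
have lg1 : 1 <= log2 n := log2_ge1 R V1.
have lg0 : 0 < log2 n := lt_le_trans ltr01 lg1.
pose k := `|Num.ceil (log2 n)|%N.
have ceil_ge1 : 0 < Num.ceil (log2 n) by rewrite ceil_gt0.
have kE : (Num.ceil (log2 n))%:~R = k%:R :> R.
  by rewrite /k -[in LHS](gez0_abs (ltW ceil_ge1)).
have k0 : (0 < k)%N by rewrite absz_gt0 gt_eqF.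
have kge : log2 n <= k%:R by rewrite -kE ceil_ge.
have kle : k%:R <= 2 * log2 n by rewrite -kE ceil_log2_le.
have l0 : 0 < l by rewrite ltr0n.
have r0 : 0 < r by rewrite ltr0n (leq_trans A1).
have k1 : 1 <= k%:R :> R by rewrite ler1n.
have hm1 : 200 * k%:R ^+ 10 * (r * l `^ (1 / 3)) <= m.
  apply: le_trans hm; rewrite -kE ler_wpM2l ?le_max ?lexx //.
  by rewrite mulr_ge0 // kE exprn_ge0.
(* This is the cube of [hm1], since [4 ^ 3 * 48 ^ 2 <= 200 ^ 3] and [k ^ 8 <= k ^ 30]. *)
have hm3 : (4 ^ 3 * (48 ^ 2 * k ^ 8 * (#|A| * #|B| ^ 3))
            <= #|edges_between adj A B| ^ 3)%N.
  rewrite -(ler_nat R) !(natrX, natrM) -/l -/r -/m.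
  have l3 : (l `^ (1 / 3)) ^+ 3 = l.
    by rewrite -powR_mulrn ?powR_ge0 // -powRrM mul1r mulVf // powRr1 // ltW.
  have hm1_ge0 : 0 <= 200 * k%:R ^+ 10 * (r * l `^ (1 / 3)).
    by rewrite !mulr_ge0 ?powR_ge0 ?ltW ?exprn_gt0 // (lt_le_trans ltr01).
  apply: le_trans (lerXn2r 3 hm1_ge0 (ler0n _ _) hm1).
  rewrite [leRHS](_ : _ = 200 ^+ 3 * k%:R ^+ 30
                          * ((l `^ (1 / 3)) ^+ 3 * r ^+ 3)); last by ring.
  rewrite l3 (mulrA (4 ^+ 3)) ler_wpM2r ?mulr_ge0 ?exprn_ge0 ?(ltW r0) ?(ltW l0) //.
  rewrite (mulrA (4 ^+ 3)); apply: ler_pM; rewrite ?mulr_ge0 ?exprn_ge0 //.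
    by lra.
  by rewrite ler_weXn2l.
have := C6_supersaturation Gadj k0 (natr_le_exp2 V0 kge) AB hm3.
rewrite -(ler_nat R) !(natrX, natrM) -/l -/r -/m -/t => main.
have lr0 : 0 < l ^+ 3 * r ^+ 3 by rewrite mulr_gt0 ?exprn_gt0.
rewrite ler_pdivrMr; last by rewrite mulr_gt0 ?(exprn_gt0 _ lg0).
rewrite ler_pdivrMl //.
apply: (le_trans main).
(* It remains to compare [k ^ 12] with [2 ^ 12 * log2 n ^ 70]; raising the exponent from 12 to 70 is
   allowed as [log2 n >= 1]. *)
rewrite [leRHS](_ : _ = 4 ^+ 6 * (8 * (2 ^+ 12 * log2 n ^+ 70)
            * (l ^+ 3 * r ^+ 3) * (6 ^+ 6 * t))); last by rewrite /C; ring.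
rewrite ler_wpM2l ?exprn_ge0 // ler_wpM2r ?mulr_ge0 ?exprn_ge0 //.
rewrite ler_wpM2r ?(ltW lr0) // ler_wpM2l //.
rewrite (le_trans (lerXn2r 12 _ _ kle)) ?nnegrE //; first by lra.
rewrite exprMn ler_wpM2l // ?exprn_ge0 //.
by rewrite ler_weXn2l.
Qed.
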